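(* Let $k,n\ge0$. There are equalities of functors $\underline\Lambda_{n,k}\to\underline\Lambda_{k,n}^{op}$ $$\mathsf l\circ\mathsf s_2=(\mathsf s_1^{op})^{-1}\circ\mathsf l=(\mathsf s_2^{op})^{-1}\circ\mathsf r=\mathsf r\circ\mathsf s_1.$$
   Context: For $n\ge0$, $\Lambda_n$ is the linearly ordered set $\mathbb Z$ equipped with the $\mathbb Z$-action $(\lambda,m)\mapsto\lambda+(n+1)m$. The 2-category $\underline\Lambda$ has objects $\Lambda_n$, 1-morphisms the $\mathbb Z$-equivariant order-preserving maps, and 2-morphisms the natural transformations (pointwise order). $\underline\Lambda_{n,k}=\underline\Lambda(\Lambda_k,\Lambda_n)$ is the resulting poset. Every 1-morphism of $\underline\Lambda$ has a (unique) left adjoint and a (unique) right adjoint; $\mathsf l,\mathsf r\colon\underline\Lambda_{n,k}\to\underline\Lambda_{k,n}^{op}$ send $f\colon\Lambda_k\to\Lambda_n$ to its left adjoint, resp. right adjoint, $\Lambda_n\to\Lambda_k$. Let $\mathsf t\colon\Lambda_n\to\Lambda_n$ be $\lambda\mapsto\lambda+1$. On $\underline\Lambda_{n,k}$ the automorphisms $\mathsf s_1,\mathsf s_2$ are $\mathsf s_1(f)=\mathsf t\circ f$ and $\mathsf s_2(f)=f\circ\mathsf t$, and similarly on $\underline\Lambda_{k,n}$; $\mathsf s_i^{op}$ is the induced automorphism of $\underline\Lambda_{k,n}^{op}$. *)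

(* Defs.v *)
From HB Require Import structures.
From mathcomp Require Import all_boot all_order all_algebra zify ring.
From mathcomp Require Import boolp.

Set Implicit Arguments.
Unset Strict Implicit.
Unset Printing Implicit Defensive.

Import Order.TTheory GRing.Theory Num.Theory.

Local Open Scope ring_scope.

(* Order-preserving maps as functors between posets; T^d is the opposite of
   the poset T. *)

Section PosetFunctors.
Context {d d' d'' : Order.disp_t}.

Lemma omorphP (T : porderType d) (T' : porderType d')
    (f g : {omorphism T -> T'}) : f =1 g -> f = g.
Proof.
move=> /funext; case: f g => f [[fP]] [g [[gP]]] /= fg.
by case: _ / fg gP => gP; rewrite (Prop_irrelevance fP gP).
Qed.

Definition ocomp (T : porderType d) (T' : porderType d') (T'' : porderType d'')
    (g : {omorphism T' -> T''}) (f : {omorphism T -> T'}) :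
  {omorphism T -> T''} := [the {omorphism T -> T''} of g \o f].

End PosetFunctors.

Definition mk_omorph d (T : porderType d) d' (T' : porderType d')
    (f : T -> T') (fP : {homo f : x y / (x <= y)%O}) : {omorphism T -> T'} :=
  HB.pack f (Order.isOrderMorphism.Build d T d' T' f fP).

Record oaut d (T : porderType d) := OAut {
  oaut_fun :> {omorphism T -> T};
  oaut_inv : {omorphism T -> T};
  oautK : cancel oaut_fun oaut_inv;
  oautVK : cancel oaut_inv oaut_fun }.

Definition oautV d (T : porderType d) (s : oaut T) : oaut T :=
  OAut (oautVK s) (oautK s).

Lemma omorph_op_subproof d (T : porderType d) d' (T' : porderType d')
    (f : {omorphism T -> T'}) :
  {homo (f : T^d -> T'^d) : x y / (x <= y)%O}.
Proof. by move=> x y; rewrite !leEdual; apply: omorph_le. Qed.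

Definition omorph_op d (T : porderType d) d' (T' : porderType d')
    (f : {omorphism T -> T'}) : {omorphism T^d -> T'^d} :=
  mk_omorph (@omorph_op_subproof d T d' T' f).

Definition oaut_op d (T : porderType d) (s : oaut T) : oaut T^d :=
  @OAut _ T^d (omorph_op s) (omorph_op (oaut_inv s)) (oautK s) (oautVK s).

(* The parameter n only serves to select the action. *)
Definition Lam (n : nat) : Type := int.
HB.instance Definition _ (n : nat) := Order.Total.on (Lam n).

Definition lam_act (n : nat) (x : Lam n) (m : int) : Lam n :=
  (x : int) + (n.+1)%:Z * m.

(* Index order: LamHom n k consists of the maps Lam k -> Lam n. *)
Record LamHom (n k : nat) := MkLamHom {
  lam_fun :> Lam k -> Lam n;
  lam_homo : {homo lam_fun : x y / (x <= y)%O};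
  lam_equiv : forall x m, lam_fun (lam_act x m) = lam_act (lam_fun x) m }.

Lemma LamHomP n k (f g : LamHom n k) : f =1 g -> f = g.
Proof.
move=> /funext; case: f g => f f1 f2 [g g1 g2] /= fg; case: _ / fg g1 g2 => g1 g2.
by rewrite (Prop_irrelevance f1 g1) (Prop_irrelevance f2 g2).
Qed.

HB.instance Definition _ n k := gen_eqMixin (LamHom n k).
HB.instance Definition _ n k := gen_choiceMixin (LamHom n k).

Section LamHomOrder.
Variables n k : nat.

Definition lam_le (f g : LamHom n k) : bool := `[< forall x, (f x <= g x)%O >].

Fact lam_le_refl : reflexive lam_le.
Proof. by move=> f; apply/asboolP => x. Qed.

Fact lam_le_anti : antisymmetric lam_le.
Proof.
move=> f g /andP[/asboolP fg /asboolP gf]; apply: LamHomP => x.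
by apply/eqP; rewrite eq_le fg gf.
Qed.

Fact lam_le_trans : transitive lam_le.
Proof.
move=> g f h /asboolP fg /asboolP gh; apply/asboolP => x.
exact: le_trans (fg x) (gh x).
Qed.

Fact lam_display : Order.disp_t. Proof. exact: (Order.Disp tt tt). Qed.

HB.instance Definition _ := Order.Le_isPOrder.Build lam_display (LamHom n k)
  lam_le_refl lam_le_anti lam_le_trans.

Lemma lam_leP (f g : LamHom n k) : reflect (forall x, (f x <= g x)%O) (f <= g)%O.
Proof. exact: asboolP. Qed.

End LamHomOrder.

Definition lam_id (n : nat) : LamHom n n :=
  @MkLamHom n n id (fun _ _ => id) (fun _ _ => erefl).

Section LamComp.
Variables (n k j : nat) (g : LamHom n k) (f : LamHom k j).

Fact lam_comp_homo : {homo g \o f : x y / (x <= y)%O}.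
Proof. by move=> x y /(lam_homo f) /(lam_homo g). Qed.

Fact lam_comp_equiv x m : (g \o f) (lam_act x m) = lam_act ((g \o f) x) m.
Proof. by rewrite /= !lam_equiv. Qed.

Definition lam_comp : LamHom n j := MkLamHom lam_comp_homo lam_comp_equiv.

End LamComp.

Notation "g \oL f" := (lam_comp g f) (at level 50, left associativity).

Lemma lam_compA n k j i (h : LamHom n k) (g : LamHom k j) (f : LamHom j i) :
  h \oL (g \oL f) = (h \oL g) \oL f.
Proof. exact: LamHomP. Qed.

Lemma lam_comp1f n k (f : LamHom n k) : lam_id n \oL f = f.
Proof. exact: LamHomP. Qed.

Lemma lam_compf1 n k (f : LamHom n k) : f \oL lam_id k = f.
Proof. exact: LamHomP. Qed.

Lemma lam_comp_le n k j (g g' : LamHom n k) (f f' : LamHom k j) :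
  (g <= g')%O -> (f <= f')%O -> (g \oL f <= g' \oL f')%O.
Proof.
move=> /lam_leP gg /lam_leP ff; apply/lam_leP => x /=.
exact: le_trans (gg (f x)) (lam_homo g' (ff x)).
Qed.

(* f is left adjoint to g: unit and counit exist; the triangle identities
   hold automatically, the 2-category being locally posetal. *)
Definition lam_adjoint n k (f : LamHom n k) (g : LamHom k n) : Prop :=
  (lam_id k <= g \oL f)%O /\ (f \oL g <= lam_id n)%O.

Lemma lam_adjointP n k (f : LamHom n k) (g : LamHom k n) :
  lam_adjoint f g <-> forall x y, (f x <= y)%O = (x <= g y)%O.
Proof.
split=> [[/lam_leP u /lam_leP c] x y|H].
  apply/idP/idP => [/(lam_homo g)|/(lam_homo f)] h.
    exact: le_trans (u x) h.
  exact: le_trans h (c y).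
by split; apply/lam_leP => x /=; [rewrite -H|rewrite H].
Qed.

Lemma lam_adjoint_le n k (f f' : LamHom n k) (g g' : LamHom k n) :
  lam_adjoint f g -> lam_adjoint f' g' -> (f <= f')%O = (g' <= g)%O.
Proof.
move=> /lam_adjointP a /lam_adjointP a'.
apply/lam_leP/lam_leP => h x.
  by rewrite -a; apply: le_trans (h _) _; rewrite a'.
by rewrite a; apply: le_trans (h _); rewrite -a'.
Qed.

Lemma ladj_unique n k (f f' : LamHom n k) (g : LamHom k n) :
  lam_adjoint f g -> lam_adjoint f' g -> f = f'.
Proof.
move=> a a'; apply: le_anti.
by rewrite (lam_adjoint_le a a') (lam_adjoint_le a' a) lexx.
Qed.

Lemma radj_unique n k (f : LamHom n k) (g g' : LamHom k n) :
  lam_adjoint f g -> lam_adjoint f g' -> g = g'.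
Proof.
move=> a a'; apply: le_anti.
by rewrite -(lam_adjoint_le a a') -(lam_adjoint_le a' a) lexx.
Qed.

Lemma lam_leE n (x y : Lam n) : (x <= y)%O = ((x : int) <= (y : int)).
Proof. by []. Qed.

Lemma ladj_fun_exists n k (f : LamHom n k) (x : Lam n) :
  exists y : Lam k, forall z : Lam k, (y <= z)%O = (x <= f z)%O.
Proof.
have fE m : f (lam_act (0 : int) m) = lam_act (f (0 : int)) m by apply: lam_equiv.
pose c : int := f (0 : int); pose X : int := x.
pose B : int := - (`|X - c|%N.+1)%:Z.
pose lo : int := k.+1%:Z * B.
have lo_lt : (f lo : int) < X.
  have -> : lo = lam_act (0 : int) B :> Lam k by rewrite /lam_act add0r.
  by rewrite fE /lam_act -/c /B; clearbody c X; nia.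
have hi : exists N : nat, X <= f (lo + N%:Z).
  pose M : int := `|X - c|%N%:Z.
  exists (k.+1 * (`|X - c|%N + `|X - c|%N.+1))%N.
  have -> : lo + (k.+1 * (`|X - c|%N + `|X - c|%N.+1))%N%:Z
            = lam_act (0 : int) M :> Lam k.
    by rewrite /lam_act add0r /lo /B /M PoszM PoszD; ring.
  by rewrite fE /lam_act -/c /M; clearbody c X; nia.
case: (ex_minnP hi) => N HN Nmin.
exists (lo + N%:Z : int) => z; rewrite !lam_leE -/X.
apply/idP/idP => [Nz|xz].
  exact: le_trans HN (lam_homo f Nz).
have lz : lo <= (z : int).
  rewrite leNgt; apply/negP => /ltW /(lam_homo f) h.
  by move: (le_lt_trans (le_trans xz h) lo_lt); rewrite ltxx.
have zE : (z : int) = lo + `|(z : int) - lo|%N%:Z.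
  by move: lz; clearbody lo; move: (z : int) => w; lia.
have := Nmin `|(z : int) - lo|%N; rewrite -zE => /(_ xz).
by rewrite [in X in _ -> X]zE lerD2l lez_nat.
Qed.

Lemma ladj_exists n k (f : LamHom n k) : exists g : LamHom k n, lam_adjoint g f.
Proof.
have [g gP] := choice (ladj_fun_exists f).
have g_homo : {homo g : x y / (x <= y)%O}.
  by move=> x y xy; rewrite gP; apply: le_trans xy _; rewrite -gP.
have actK p (x y : Lam p) m : (lam_act x m <= y)%O = (x <= lam_act y (- m))%O.
  rewrite !lam_leE /lam_act; move: (x : int) (y : int) => a b; nia.
have g_equiv x m : g (lam_act x m) = lam_act (g x) m.
  have E z : (g (lam_act x m) <= z)%O = (lam_act (g x) m <= z)%O.
    by rewrite gP !actK gP lam_equiv.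
  by apply/eqP; rewrite eq_le E lexx -E lexx.
by exists (MkLamHom g_homo g_equiv); apply/lam_adjointP => x y; apply: gP.
Qed.

Section Reflect.
Variables (n k : nat) (f : LamHom n k).

Let opp_fun (x : Lam k) : Lam n := - (f (- (x : int)) : int).

Fact lam_opp_homo : {homo opp_fun : x y / (x <= y)%O}.
Proof.
by move=> x y; rewrite !lam_leE => xy; rewrite lerN2; apply: lam_homo; rewrite lam_leE lerN2.
Qed.

Fact lam_opp_equiv x m : opp_fun (lam_act x m) = lam_act (opp_fun x) m.
Proof.
rewrite /opp_fun; have -> : - (lam_act x m : int) = lam_act (- (x : int)) (- m) :> Lam k.
  by rewrite /lam_act opprD mulrN.
by rewrite lam_equiv /lam_act opprD mulrN opprK.
Qed.

Definition lam_opp : LamHom n k := MkLamHom lam_opp_homo lam_opp_equiv.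

End Reflect.

Lemma radj_exists n k (f : LamHom n k) : exists g : LamHom k n, lam_adjoint f g.
Proof.
have [g /lam_adjointP gP] := ladj_exists (lam_opp f).
exists (lam_opp g); apply/lam_adjointP => x y.
have := gP (- (y : int)) (- (x : int)).
by rewrite !lam_leE /= opprK lerN2 lerNr => ->.
Qed.

(* Chosen by existence; ladj_unique and radj_unique show there is no choice. *)
Definition ladj n k (f : LamHom n k) : LamHom k n := sval (cid (ladj_exists f)).
Definition radj n k (f : LamHom n k) : LamHom k n := sval (cid (radj_exists f)).

Lemma ladjP n k (f : LamHom n k) : lam_adjoint (ladj f) f.
Proof. exact: svalP (cid (ladj_exists f)). Qed.

Lemma radjP n k (f : LamHom n k) : lam_adjoint f (radj f).
Proof. exact: svalP (cid (radj_exists f)). Qed.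

Fact lam_l_homo n k :
  {homo (@ladj n k : LamHom n k -> (LamHom k n)^d) : f g / (f <= g)%O}.
Proof. by move=> f g; rewrite leEdual (lam_adjoint_le (ladjP g) (ladjP f)). Qed.

Fact lam_r_homo n k :
  {homo (@radj n k : LamHom n k -> (LamHom k n)^d) : f g / (f <= g)%O}.
Proof. by move=> f g; rewrite leEdual (lam_adjoint_le (radjP f) (radjP g)). Qed.

Definition lam_l n k : {omorphism LamHom n k -> (LamHom k n)^d} :=
  mk_omorph (@lam_l_homo n k).
Definition lam_r n k : {omorphism LamHom n k -> (LamHom k n)^d} :=
  mk_omorph (@lam_r_homo n k).

Section Translation.
Variables (n : nat) (c : int).

Let shift_fun (x : Lam n) : Lam n := (x : int) + c.

Fact lam_shift_homo : {homo shift_fun : x y / (x <= y)%O}.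
Proof. by move=> x y; rewrite !lam_leE lerD2r. Qed.

Fact lam_shift_equiv x m : shift_fun (lam_act x m) = lam_act (shift_fun x) m.
Proof. by rewrite /shift_fun /lam_act addrAC. Qed.

Definition lam_shift : LamHom n n := MkLamHom lam_shift_homo lam_shift_equiv.

End Translation.

Definition lam_t (n : nat) : LamHom n n := lam_shift n 1.
Definition lam_tV (n : nat) : LamHom n n := lam_shift n (- 1).

Lemma lam_tK n : lam_tV n \oL lam_t n = lam_id n.
Proof. by apply: LamHomP => x; apply: (addrK (1 : int)). Qed.

Lemma lam_tVK n : lam_t n \oL lam_tV n = lam_id n.
Proof. by apply: LamHomP => x; apply: (subrK (1 : int)). Qed.

Section Automorphisms.
Variables n k : nat.

Definition lam_post (u : LamHom n n) : {omorphism LamHom n k -> LamHom n k} :=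
  mk_omorph (fun _ _ => @lam_comp_le n n k u u _ _ (lexx u)).

Definition lam_pre (u : LamHom k k) : {omorphism LamHom n k -> LamHom n k} :=
  mk_omorph (fun _ _ fg => @lam_comp_le n k k _ _ u u fg (lexx u)).

Fact lam_s1K : cancel (lam_post (lam_t n)) (lam_post (lam_tV n)).
Proof. by move=> f; rewrite /= lam_compA lam_tK lam_comp1f. Qed.

Fact lam_s1VK : cancel (lam_post (lam_tV n)) (lam_post (lam_t n)).
Proof. by move=> f; rewrite /= lam_compA lam_tVK lam_comp1f. Qed.

Fact lam_s2K : cancel (lam_pre (lam_t k)) (lam_pre (lam_tV k)).
Proof. by move=> f; rewrite /= -lam_compA lam_tVK lam_compf1. Qed.

Fact lam_s2VK : cancel (lam_pre (lam_tV k)) (lam_pre (lam_t k)).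
Proof. by move=> f; rewrite /= -lam_compA lam_tK lam_compf1. Qed.

Definition lam_s1 : oaut (LamHom n k) := OAut lam_s1K lam_s1VK.
Definition lam_s2 : oaut (LamHom n k) := OAut lam_s2K lam_s2VK.

End Automorphisms.

(* Main.v *)
Require Import Defs.
From mathcomp Require Import all_boot all_order.
From mathcomp Require Import all_algebra zify.

(** The outer equalities say that adjoints reverse composition and that the
    adjoints of a translation are its inverse. The middle one holds because
    the objects are copies of [int], where a negated Galois connection is again
    one: [f x <= y - 1] iff not [y <= f x] iff not [ladj f y <= x] iff
    [x <= ladj f y - 1]. *)

Lemma lam_adjoint_comp (n k j : nat) (f : LamHom n k) (g : LamHom k n)
    (f' : LamHom k j) (g' : LamHom j k) :
  lam_adjoint f g -> lam_adjoint f' g' -> lam_adjoint (f \oL f') (g' \oL g).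
Proof.
move=> /lam_adjointP a /lam_adjointP a'.
by apply/lam_adjointP => x y /=; rewrite a a'.
Qed.

(** Unit and counit are equalities, since the two translations are mutually inverse. *)
Lemma lam_adjoint_t (n : nat) : lam_adjoint (lam_t n) (lam_tV n).
Proof. by rewrite /lam_adjoint lam_tK lam_tVK !Order.POrderTheory.lexx. Qed.

Lemma lam_adjoint_tV (n : nat) : lam_adjoint (lam_tV n) (lam_t n).
Proof. by rewrite /lam_adjoint lam_tK lam_tVK !Order.POrderTheory.lexx. Qed.

Lemma ladj_comp_t (n k : nat) (f : LamHom n k) :
  ladj (f \oL lam_t k) = lam_tV k \oL ladj f.
Proof.
apply: ladj_unique (ladjP _) _.
exact: lam_adjoint_comp (lam_adjoint_tV k) (ladjP f).
Qed.

Lemma radj_t_comp (n k : nat) (f : LamHom n k) :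
  radj (lam_t n \oL f) = radj f \oL lam_tV n.
Proof.
apply: radj_unique (radjP _) _.
exact: lam_adjoint_comp (lam_adjoint_t n) (radjP f).
Qed.

Lemma lam_adjoint_t_comp (n k : nat) (f : LamHom n k) (g : LamHom k n) :
  lam_adjoint g f -> lam_adjoint (lam_t n \oL f) (lam_tV k \oL g).
Proof.
move=> /lam_adjointP a; apply/lam_adjointP => x y.
(* Negating both sides of [a y x] turns [y <= f x] into [f x + 1 <= y] and [g y <= x] into
   [x <= g y - 1]. *)
have := a y x; rewrite !lam_leE /=.
by move: (f x : int) (g y : int) => u v; lia.
Qed.

Lemma tV_comp_ladj (n k : nat) (f : LamHom n k) :
  lam_tV k \oL ladj f = radj f \oL lam_tV n.
Proof.
(* Both sides become right adjoints of [lam_t n \oL f]. *)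
rewrite -radj_t_comp; apply: (radj_unique _ (radjP _)).
exact: lam_adjoint_t_comp (ladjP f).
Qed.

Theorem proposition3p15 (k n : nat) :
  [/\ ocomp (lam_l n k) (lam_s2 n k)
        = ocomp (oautV (oaut_op (lam_s1 k n))) (lam_l n k),
      ocomp (oautV (oaut_op (lam_s1 k n))) (lam_l n k)
        = ocomp (oautV (oaut_op (lam_s2 k n))) (lam_r n k)
    & ocomp (oautV (oaut_op (lam_s2 k n))) (lam_r n k)
        = ocomp (lam_r n k) (lam_s1 n k)].
Proof.
(* On underlying maps, the inverses of [lam_s1] and [lam_s2] are post- and precomposition with
   [lam_tV]. *)
split; apply: omorphP => f /=.
- exact: ladj_comp_t.
- exact: tV_comp_ladj.
- exact/esym/radj_t_comp.
Qed.
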